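(* There are absolute constants $c>0$ and $\epsilon_0\in(0,1)$ such that the following holds for all integers $d\ge 1$, $l\ge 1$ and all $\epsilon\in(0,\epsilon_0]$. Let $g:\mathbb R^d\to\mathbb R^d$ be a random neural network of the form $$g(\mathbf x)=\mathbf M_l\,\sigma(\mathbf M_{l-1}\cdots\sigma(\mathbf M_1\mathbf x)),$$ where $\mathbf M_1,\dots,\mathbf M_l$ are random matrices of fixed compatible dimensions with arbitrary distributions. Let $\mathcal G$ be the (random) set of networks obtained by pruning $g$, i.e. the set of all functions $$\widehat g(\mathbf x)=(\mathbf S_l\odot\mathbf M_l)\,\sigma(\cdots\sigma((\mathbf S_1\odot\mathbf M_1)\mathbf x)),$$ where each $\mathbf S_i$ is a matrix with entries in $\{0,1\}$ of the same dimensions as $\mathbf M_i$. Let $$\mathcal F=\{h_{\mathbf W}:\mathbf W\in\mathbb R^{d\times d},\ \|\mathbf W\|\le 1\},\qquad h_{\mathbf W}(\mathbf x)=\begin{bmatrix}\mathbf I&-\mathbf I\end{bmatrix}\sigma\left(\begin{bmatrix}\mathbf W\\-\mathbf W\end{bmatrix}\mathbf x\right).$$ Suppose that $$\forall h\in\mathcal F:\quad \mathbb P\left(\exists g'\in\mathcal G:\ \sup_{\mathbf x\in\mathbb R^d:\|\mathbf x\|\le 1}\|h(\mathbf x)-g'(\mathbf x)\|<\epsilon\right)\ge\frac12 .$$ Then $g$ has at least $c\,d^2\log(1/\epsilon)$ parameters. Further, if $l=2$, then the width of $g$ is at least $c\,d\log(1/\epsilon)$.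
   Context: $\sigma(x)=\max\{x,0\}$ is the ReLU function, applied entrywise to vectors; it is applied after every linear map except the last one. $\odot$ is the entrywise product of matrices. $\mathbf I$ is the $d\times d$ identity matrix. For vectors, $\|\cdot\|$ is the Euclidean norm; for matrices, it is the operator (spectral) norm. The number of parameters of $g$ is the total number of entries of $\mathbf M_1,\dots,\mathbf M_l$. For $l=2$, with $\mathbf M_1$ of dimension $s\times d$ and $\mathbf M_2$ of dimension $d\times s$, the width of $g$ is $s$. *)

(* Defs.v *)
From mathcomp Require Import all_boot all_order all_algebra.
From mathcomp Require Import all_classical all_reals all_analysis.

Set Implicit Arguments.
Unset Strict Implicit.
Unset Printing Implicit Defensive.

Import Order.TTheory GRing.Theory Num.Theory.
Local Open Scope classical_set_scope.
Local Open Scope ring_scope.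

(* The library norm on matrices is the max norm, hence these two norms. *)
Definition enorm (R : realType) (n : nat) (x : 'cV[R]_n) : R :=
  Num.sqrt (\sum_i x i 0 ^+ 2).

Definition opnorm (R : realType) (m n : nat) (A : 'M[R]_(m, n)) : R :=
  sup [set enorm (A *m x) | x in [set x : 'cV[R]_n | enorm x <= 1]].

Definition relu (R : realType) (n : nat) (x : 'cV[R]_n) : 'cV[R]_n :=
  map_mx (fun a => Num.max a 0) x.

Definition hadamard (R : realType) (m n : nat) (A B : 'M[R]_(m, n)) :
  'M[R]_(m, n) := map2_mx *%R A B.

(* [layers T m hs n] is the type of tuples (M_1, ..., M_l) of matrices over T
   with input dimension m, output dimension n and hidden dimensions hs, so that
   l = (size hs).+1. M_1 comes first. *)
Fixpoint layers (T : Type) (m : nat) (hs : seq nat) (n : nat) : Type :=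
  if hs is s :: hs' then ('M[T]_(s, m) * layers T s hs' n)%type
  else 'M[T]_(n, m).

Fixpoint nparams (m : nat) (hs : seq nat) (n : nat) : nat :=
  if hs is s :: hs' then (s * m + nparams s hs' n)%N else (n * m)%N.

Fixpoint map_layers (T U : Type) (f : T -> U) (m : nat) (hs : seq nat)
    (n : nat) : layers T m hs n -> layers U m hs n :=
  match hs return layers T m hs n -> layers U m hs n with
  | [::] => fun M => map_mx f M
  | s :: hs' => fun M => (map_mx f M.1, map_layers f M.2)
  end.

Fixpoint hadamard_layers (R : realType) (m : nat) (hs : seq nat) (n : nat) :
    layers R m hs n -> layers R m hs n -> layers R m hs n :=
  match hs return layers R m hs n -> layers R m hs n -> layers R m hs n with
  | [::] => fun S M => hadamard S M
  | s :: hs' => fun S M => (hadamard S.1 M.1, hadamard_layers S.2 M.2)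
  end.

Fixpoint network (R : realType) (m : nat) (hs : seq nat) (n : nat) :
    layers R m hs n -> 'cV[R]_m -> 'cV[R]_n :=
  match hs return layers R m hs n -> 'cV[R]_m -> 'cV[R]_n with
  | [::] => fun M x => M *m x
  | s :: hs' => fun M x => network M.2 (relu (M.1 *m x))
  end.

(* Masks are Boolean; b%:R is 0 or 1. *)
Definition pruned (R : realType) (m : nat) (hs : seq nat) (n : nat)
    (M : layers R m hs n) : set ('cV[R]_m -> 'cV[R]_n) :=
  [set network (hadamard_layers (map_layers (fun b : bool => b%:R) S) M)
  | S in [set: layers bool m hs n]].

Definition target (R : realType) (d : nat) (W : 'M[R]_d) (x : 'cV[R]_d) :
  'cV[R]_d := row_mx 1%:M (- 1%:M) *m relu (col_mx W (- W) *m x).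

Definition target_class (R : realType) (d : nat) :
    set ('cV[R]_d -> 'cV[R]_d) :=
  [set target W | W in [set W : 'M[R]_d | opnorm W <= 1]].

Definition ball_dist (R : realType) (m n : nat)
    (f g : 'cV[R]_m -> 'cV[R]_n) : \bar R :=
  ereal_sup [set (enorm (f x - g x))%:E
            | x in [set x : 'cV[R]_m | enorm x <= 1]].

(* A random tuple of matrices is one whose entries are random variables on a
   common probability space, with no assumption on their joint law. *)
Definition realization (disp : measure_display) (Omega : measurableType disp)
    (R : realType) (P : probability Omega R) (m : nat) (hs : seq nat) (n : nat)
    (M : layers {RV P >-> R} m hs n) (w : Omega) : layers R m hs n :=
  map_layers (fun X : {RV P >-> R} => X w) M.

(* Main.v *)
Require Import Defs.
From mathcomp Require Import all_boot all_order all_algebra.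
From mathcomp Require Import all_classical all_reals all_analysis.
From mathcomp Require Import measurable_realfun.
From mathcomp Require Import lra.
Import Order.TTheory GRing.Theory Num.Theory.
Import numFieldNormedType.Exports.
Local Open Scope classical_set_scope.
Local Open Scope ring_scope.

Set Implicit Arguments.
Unset Strict Implicit.
Unset Printing Implicit Defensive.

(** Since [target W] is [W *m x], one pruned network can be eps-close to
    [target U] and [target V] only if U and V are at operator distance at most
    2 eps. The events attached to a family of matrices of the unit ball with
    pairwise distances larger than 2 eps are therefore disjoint for each fixed
    mask; as there are 2 ^ p masks for p parameters, and each matrix has
    probability at least 1/2 of being approximated, the family has at most
    2 * 2 ^ p members. A largest such family covers the unit ball at scale
    2 eps, which requires at least (2 eps)^-(d^2) balls. This covering bound is
    obtained without volumes: iterating the cover k times gives N ^ k balls of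
    radius (2 eps) ^ k, and counting grid points yields the bound up to a
    constant independent of k, which vanishes in the limit. *)

(** * Euclidean and operator norms *)

Section Norms.
Variable R : realType.

Lemma enorm_ge0 (n : nat) (x : 'cV[R]_n) : 0 <= enorm x.
Proof. exact: sqrtr_ge0. Qed.

Lemma sqr_enorm (n : nat) (x : 'cV[R]_n) : enorm x ^+ 2 = \sum_i x i 0 ^+ 2.
Proof. by rewrite sqr_sqrtr// sumr_ge0// => i _; exact: sqr_ge0. Qed.

Lemma enorm_leE (n : nat) (x : 'cV[R]_n) (c : R) :
  0 <= c -> (enorm x <= c) = (\sum_i x i 0 ^+ 2 <= c ^+ 2).
Proof.
by move=> c0; rewrite -sqr_enorm ler_pXn2r// nnegrE enorm_ge0.
Qed.

Lemma normr_coord_le_enorm (n : nat) (x : 'cV[R]_n) (i : 'I_n) :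
  `|x i 0| <= enorm x.
Proof.
rewrite -[leLHS]ger0_norm// -ler_sqr ?nnegrE ?enorm_ge0// normr_id.
rewrite sqr_enorm real_normK ?num_real// (bigD1 i)//= lerDl sumr_ge0// => j _.
exact: sqr_ge0.
Qed.

Lemma enorm_delta (n : nat) (j : 'I_n) : enorm (delta_mx j 0 : 'cV[R]_n) = 1.
Proof.
rewrite /enorm (bigD1 j)//= big1 => [|i /negbTE ij].
  by rewrite mxE !eqxx expr1n addr0 sqrtr1.
by rewrite mxE ij expr0n.
Qed.

Lemma enormZ (n : nat) (a : R) (x : 'cV[R]_n) :
  0 <= a -> enorm (a *: x) = a * enorm x.
Proof.
move=> a0; apply/eqP; rewrite -(@eqrXn2 _ 2) ?mulr_ge0 ?enorm_ge0//.
rewrite exprMn !sqr_enorm mulr_sumr; apply/eqP/eq_bigr => i _.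
by rewrite mxE exprMn.
Qed.

(* The triangle inequality is only needed for two vectors with the same bound,
   where (a + b)^2 <= 2 a^2 + 2 b^2 replaces Cauchy-Schwarz. *)
Lemma enormB_le (n : nat) (x y : 'cV[R]_n) (c : R) :
  enorm x <= c -> enorm y <= c -> enorm (x - y) <= 2 * c.
Proof.
move=> xc yc; have c0 : 0 <= c := le_trans (enorm_ge0 x) xc.
move: xc yc; rewrite !enorm_leE ?mulr_ge0// => xc yc.
apply: (@le_trans _ _ (\sum_i (2 * x i 0 ^+ 2 + 2 * y i 0 ^+ 2))).
  apply: ler_sum => i _; rewrite !mxE.
  have := sqr_ge0 (x i 0 + y i 0); nra.
by rewrite big_split /= -!mulr_sumr; nra.
Qed.

(* The ball of radius c for the operator norm, stated without the supremum in
   [opnorm]. *)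
Definition opball (m n : nat) (c : R) (W : 'M[R]_(m, n)) : Prop :=
  forall x : 'cV[R]_n, enorm x <= 1 -> enorm (W *m x) <= c.

Lemma opball_opnorm (m n : nat) (W : 'M[R]_(m, n)) :
  opball 1 W -> opnorm W <= 1.
Proof.
move=> WB; apply: ge_sup; last by move=> _ [x /= x1 <-]; exact: WB.
exists (enorm (W *m 0)); exists 0 => //=.
by rewrite enorm_leE// big1 ?expr1n// => i _; rewrite mxE expr0n.
Qed.

Lemma opballZ (m n : nat) (a c : R) (W : 'M[R]_(m, n)) :
  0 <= a -> opball c W -> opball (a * c) (a *: W).
Proof.
move=> a0 WB x x1; rewrite -scalemxAl enormZ//.
by rewrite ler_wpM2l// WB.
Qed.

Lemma opball_coord (m n : nat) (c : R) (W : 'M[R]_(m, n)) i j :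
  opball c W -> `|W i j| <= c.
Proof.
move=> WB; have := WB (delta_mx j 0); rewrite enorm_delta => /(_ (lexx _)).
apply: le_trans; have := normr_coord_le_enorm (W *m delta_mx j 0) i.
by rewrite -colE !mxE.
Qed.

(** A crude bound: each coordinate of [W *m x] is at most d / d^2 = 1/d, and the d squares then sum
    to at most 1. *)
Lemma coord_opball (d : nat) (W : 'M[R]_d) : (0 < d)%N ->
  (forall i j, `|W i j| <= (d%:R ^+ 2)^-1) -> opball 1 W.
Proof.
move=> d0 Wd x x1; have dR : 1 <= d%:R :> R by rewrite ler1n.
have d1 : 0 < d%:R :> R by rewrite ltr0n.
rewrite enorm_leE// expr1n.
apply: (@le_trans _ _ (\sum_(i < d) (d%:R^-1 : R))); last first.
  by rewrite sumr_const card_ord -[_ *+ d]mulr_natl divff ?gt_eqF.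
apply: ler_sum => i _; rewrite -real_normK ?num_real//.
apply: (@le_trans _ _ (d%:R^-1 ^+ 2)).
  rewrite ler_pXn2r ?nnegrE ?invr_ge0 ?(ltW d1)//.
  rewrite mxE; apply: (le_trans (ler_norm_sum _ _ _)).
  apply: (@le_trans _ _ (\sum_(j < d) (d%:R ^+ 2)^-1)).
    apply: ler_sum => j _; rewrite normrM.
    rewrite -[leRHS]mulr1 ler_pM//.
    exact: le_trans (normr_coord_le_enorm x j) x1.
  rewrite sumr_const card_ord -[_ *+ d]mulr_natl expr2 invfM mulrA divff
    ?mul1r//.
  by rewrite gt_eqF.
rewrite exprVn lef_pV2 ?posrE ?exprn_gt0//.
by rewrite expr2 ler_peMr// ltW.
Qed.

(** * Covering and packing of the operator-norm ball *)

Definition covers (d : nat) (r : R) (s : seq 'M[R]_d) : Prop :=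
  forall W, opball 1 W -> exists2 V, V \in s & opball r (W - V).

(** The residual left by a cover at scale [r ^+ k], rescaled to the unit ball, is covered by [s]
    once more. *)
Lemma covers_iter (d : nat) (r : R) (s : seq 'M[R]_d) (k : nat) :
  0 < r -> covers r s ->
  exists2 t : seq 'M[R]_d, size t = (size s ^ k)%N & covers (r ^+ k) t.
Proof.
move=> r0 sr; elim: k => [|k [t st tr]].
  by exists [:: 0] => // W W1; exists 0; rewrite ?inE ?subr0.
exists [seq U + r ^+ k *: V | U <- t, V <- s].
  by rewrite size_allpairs st expnSr.
move=> W W1; have [U Ut WU] := tr _ W1.
have rk0 : 0 < r ^+ k by rewrite exprn_gt0.
have [|V Vs WV] := sr ((r ^+ k)^-1 *: (W - U)).
  by rewrite -(mulVf (lt0r_neq0 rk0)); apply: opballZ; rewrite ?invr_ge0 ?ltW.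
exists (U + r ^+ k *: V); first by apply/allpairsP; exists (U, V).
rewrite exprSr opprD addrA.
suff -> : W - U - r ^+ k *: V = r ^+ k *: ((r ^+ k)^-1 *: (W - U) - V).
  by apply: opballZ => //; exact: ltW.
by rewrite scalerBr scalerA divff ?scale1r// lt0r_neq0.
Qed.

(* The grid of mesh 3r in the cube of side 1/d^2: two of its points cannot be
   covered by the same ball of radius r. *)
Lemma covers_size_ge (d : nat) (r : R) (s : seq 'M[R]_d) : (0 < d)%N ->
  0 < r -> covers r s -> (3 * d%:R ^+ 2 * r)^-1 ^+ (d * d) <= (size s)%:R.
Proof.
move=> d0 r0 sr; have d1 : 0 < d%:R :> R by rewrite ltr0n.
set a := (3 * d%:R ^+ 2 * r)^-1.
have a0 : 0 <= a by rewrite invr_ge0 !mulr_ge0 ?exprn_ge0 ?(ltW r0).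
(* [a] is the number of steps 3r in the side 1/d^2; the m + 1 > [a] grid values per entry give the
   bound. *)
pose m := Num.truncn a.
pose F (g : 'M['I_m.+1]_d) : 'M[R]_d :=
  \matrix_(i, j) (3 * r * (g i j : nat)%:R).
have FB g : opball 1 (F g).
  apply: coord_opball => // i j; rewrite mxE ger0_norm ?mulr_ge0 ?(ltW r0)//.
  apply: (@le_trans _ _ (3 * r * a)).
    rewrite ler_wpM2l ?mulr_ge0 ?(ltW r0)//.
    apply: (@le_trans _ _ m%:R); first by rewrite ler_nat -ltnS.
    by rewrite truncn_le.
  rewrite /a [3 * _ * r]mulrAC invfM mulrA divff ?mul1r//.
  by rewrite lt0r_neq0// mulr_gt0.
have /choice[f fP] : forall g, exists V, V \in s /\ opball r (F g - V).
  by move=> g; have [V ? ?] := sr _ (FB g); exists V.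
(* Entries of two matrices in the same ball differ by at most 2r, whereas distinct grid values
   differ by at least 3r. *)
have finj : injective f.
  move=> g h fgh; apply/matrixP => i j; apply/val_inj/eqP/negPn/negP => /= ghij.
  have [_ /opball_coord -/(_ i j)] := fP g.
  have [_ /opball_coord -/(_ i j)] := fP h.
  rewrite fgh !mxE !ler_norml => /andP[h1 h2] /andP[g1 g2].
  have : r * 3 <= r * 3 * `|(g i j : nat)%:R - (h i j : nat)%:R|.
    rewrite ler_peMr ?mulr_ge0 ?(ltW r0)//.
    case: ltngtP ghij => // [gh|hg] _.
      by rewrite distrC ger0_norm ?subr_ge0 ?ler_nat 1?ltnW// -natrB 1?ltnW//
        ler1n subn_gt0.
    by rewrite ger0_norm ?subr_ge0 ?ler_nat 1?ltnW// -natrB 1?ltnW// ler1n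
      subn_gt0.
  by case: ger0P => _; lra.
have : (#|{: 'M['I_m.+1]_d}| <= size s)%N.
  rewrite cardE -(size_map f); apply: uniq_leq_size.
    by rewrite map_inj_uniq ?enum_uniq.
  by move=> _ /mapP[g _ ->]; have [] := fP g.
rewrite card_mx card_ord -(ler_nat R) natrX; apply: le_trans.
by rewrite lerXn2r ?nnegrE// ltW// truncnS_gt.
Qed.

(** If b < a, Bernoulli's inequality makes (a / b)^k at least 1 + k u with u = a / b - 1 > 0, which
    is unbounded. *)
Lemma expr_le_const_mul (a b C : R) : 0 < b ->
  (forall k, a ^+ k <= C * b ^+ k) -> a <= b.
Proof.
move=> b0 aC; rewrite leNgt; apply/negP => ba.
pose u := a / b - 1; have u0 : 0 < u by rewrite subr_gt0 ltr_pdivlMr ?mul1r.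
have uC k : 1 + u *+ k <= C.
  apply: (@le_trans _ _ ((1 + u) ^+ k)).
    elim: k => [|k IH]; first by rewrite mulr0n addr0.
    by rewrite exprS mulrS; have := mulrn_wge0 k (ltW u0); nra.
  by rewrite /u addrC subrK expr_div_n ler_pdivrMr ?exprn_gt0.
have := uC (Num.truncn (C / u)).+1.
have : C < u *+ (Num.truncn (C / u)).+1.
  by rewrite -mulr_natl -ltr_pdivrMr// truncnS_gt.
lra.
Qed.

(* The count at scale r^k costs a constant that does not depend on k; it
   disappears as k grows. *)
Lemma covers_size_sharp (d : nat) (r : R) (s : seq 'M[R]_d) : (0 < d)%N ->
  0 < r -> covers r s -> r^-1 ^+ (d * d) <= (size s)%:R.
Proof.
move=> d0 r0 sr; have d1 : 0 < d%:R :> R by rewrite ltr0n.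
apply: (@expr_le_const_mul _ _ ((3 * d%:R ^+ 2) ^+ (d * d))).
  (* The crude count serves here only to show that [s] is not empty. *)
  have := covers_size_ge d0 r0 sr; apply: lt_le_trans.
  by rewrite exprn_gt0// invr_gt0 !mulr_gt0.
move=> k; have [t st tr] := covers_iter k r0 sr.
have := covers_size_ge d0 (exprn_gt0 k r0) tr.
rewrite st natrX invfM exprMn mulrC !exprVn.
rewrite ler_pdivrMr ?exprn_gt0 ?mulr_gt0 ?exprn_gt0//.
by rewrite -!exprM mulnC [X in _ <= X]mulrC.
Qed.

Definition opseparated (d : nat) (r : R) : seq 'M[R]_d -> bool :=
  pairwise (fun U V => `[< ~ opball r (U - V) >]).

Lemma opseparated_bounded (d : nat) (r : R) (K : nat) : (0 < d)%N -> 0 < r ->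
  (forall s : seq 'M[R]_d, (forall W, W \in s -> opball 1 W) ->
    opseparated r s -> (size s <= K)%N) ->
  r^-1 ^+ (d * d) <= K%:R.
Proof.
move=> d0 r0 sK.
pose Q n := `[< exists s : seq 'M[R]_d, [/\ size s = n,
  forall W, W \in s -> opball 1 W & opseparated r s] >].
have Q0 : exists n, Q n by exists 0%N; apply/asboolP; exists [::].
have QK n : Q n -> (n <= K)%N.
  by move=> /asboolP[s [<- sB ss]]; exact: sK.
case: (ex_maxnP Q0 QK) => n /asboolP[s [sn sB ss]] nmax.
apply: (@le_trans _ _ (size s)%:R); last by rewrite ler_nat sK.
apply: covers_size_sharp => // W W1; apply: contrapT => WN.
(* A matrix left uncovered could be prepended to [s], against maximality. *)
suff /nmax : Q n.+1 by rewrite ltnn.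
apply/asboolP; exists (W :: s); split => [|V|] /=; first by rewrite sn.
  by rewrite inE => /predU1P[->//|/sB].
rewrite ss andbT; apply/allP => V Vs; apply/asboolP => WV; apply: WN.
by exists V.
Qed.

End Norms.

(** * Continuity of networks and reduction to rational points *)

Section Continuity.
Variable R : realType.

Definition coord_cvg (n : nat) (u : nat -> 'cV[R]_n) (x : 'cV[R]_n) : Prop :=
  forall i, u k i 0 @[k --> \oo] --> x i 0.

Definition coord_continuous (m n : nat) (f : 'cV[R]_m -> 'cV[R]_n) : Prop :=
  forall u x, coord_cvg u x -> coord_cvg (f \o u) (f x).

Lemma mulmx_coord_continuous (m n : nat) (M : 'M[R]_(n, m)) :
  coord_continuous (mulmx M).
Proof.
move=> u x ux i; rewrite /= mxE; under eq_cvg do rewrite mxE.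
apply: cvg_big => [|j _]; first exact: add_continuous.
by apply: cvgM; [exact: cvg_cst|exact: ux].
Qed.

Lemma relu_coord_continuous (n : nat) : coord_continuous (@relu R n).
Proof.
move=> u x ux i; rewrite /= mxE maxr_absE.
under eq_cvg do rewrite mxE maxr_absE.
apply: cvgM; last exact: cvg_cst.
have ux0 : u k i 0 + 0 @[k --> \oo] --> x i 0 + 0.
  by apply: cvgD; [exact: ux|exact: cvg_cst].
apply: cvgD => //; apply: cvg_norm.
by apply: cvgB; [exact: ux|exact: cvg_cst].
Qed.

Lemma network_coord_continuous (m : nat) (hs : seq nat) (n : nat)
  (M : layers R m hs n) : coord_continuous (network M).
Proof.
elim: hs m M => [|s hs IH] m M /= u x ux; first exact: mulmx_coord_continuous.
apply: (IH _ M.2 (fun k => relu (M.1 *m u k)) (relu (M.1 *m x))).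
apply: (relu_coord_continuous (u := fun k => M.1 *m u k)).
exact: mulmx_coord_continuous.
Qed.

Lemma enorm_coord_cvg (n : nat) (u : nat -> 'cV[R]_n) (x : 'cV[R]_n) :
  coord_cvg u x -> enorm (u k) @[k --> \oo] --> enorm x.
Proof.
move=> ux; have sq : \sum_i u k i 0 ^+ 2 @[k --> \oo] --> \sum_i x i 0 ^+ 2.
  apply: cvg_big => [|j _]; first exact: add_continuous.
  by rewrite expr2; under eq_cvg do rewrite expr2; apply: cvgM; exact: ux.
have sqrtx := @sqrt_continuous R (\sum_i x i 0 ^+ 2).
exact: (cvg_comp _ _ sq sqrtx).
Qed.

(** Entrywise, max(a, 0) - max(-a, 0) = a. *)
Lemma target_mulmx (d : nat) (W : 'M[R]_d) (x : 'cV[R]_d) :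
  target W x = W *m x.
Proof.
rewrite /target /relu mul_col_mx map_col_mx mul_row_col mul1mx mulNmx mul1mx.
apply/matrixP => i j; rewrite mulNmx !mxE.
set a := \sum_k _.
by case: (lerP a 0) => ?; case: (lerP (- a) 0) => ?; lra.
Qed.

(* Approximating from the side of 0 keeps the approximants of a point of the
   ball inside the ball. *)
Lemma rat_approx_le (a e : R) : 0 < e ->
  exists q : rat, `|ratr q : R| <= `|a| /\ `|ratr q - a| <= e.
Proof.
move=> e0; have [a0|a0|<-] := ltgtP 0 a.
- have [|q] := @rat_in_itvoo R (Num.max 0 (a - e)) a.
    by rewrite gt_max a0 ltrBlDr ltrDl.
  rewrite in_itv /= gt_max => /andP[/andP[q0 qe] qa]; exists q.
  have qa' : ratr q - a <= 0 by lra.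
  rewrite (ger0_norm (ltW a0)) (ger0_norm (ltW q0)) (ler0_norm qa').
  by split; lra.
- have [|q] := @rat_in_itvoo R a (Num.min 0 (a + e)).
    by rewrite lt_min a0 ltrDl.
  rewrite in_itv /= lt_min => /andP[qa /andP[q0 qe]]; exists q.
  have qa' : 0 <= ratr q - a by lra.
  rewrite (ler0_norm (ltW a0)) (ler0_norm (ltW q0)) (ger0_norm qa').
  by split; lra.
- by exists 0; rewrite rmorph0 subrr normr0; split=> //; exact: ltW.
Qed.

Lemma ball_rat_dense (n : nat) (x : 'cV[R]_n) : enorm x <= 1 ->
  exists q : nat -> 'cV[rat]_n,
    (forall k, enorm (map_mx ratr (q k) : 'cV[R]_n) <= 1) /\
    coord_cvg (fun k => map_mx ratr (q k)) x.
Proof.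
move=> x1.
have /choice[q qx] : forall k, exists q : 'cV[rat]_n, forall i,
    `|ratr (q i 0) : R| <= `|x i 0| /\ `|ratr (q i 0) - x i 0| <= k.+1%:R^-1.
  move=> k; have k0 : 0 < k.+1%:R^-1 :> R by rewrite invr_gt0.
  have /choice[f fP] := fun i => rat_approx_le (x i 0) k0.
  by exists (\col_i f i) => i; rewrite mxE.
exists q; split=> [k|i].
  move: x1; rewrite !enorm_leE//; apply: le_trans.
  apply: ler_sum => i _; rewrite mxE -(real_normK (num_real (ratr _))).
  rewrite -(real_normK (num_real (x i 0))) ler_pXn2r ?nnegrE//.
  by have [] := qx k i.
apply: (@squeeze_cvgr _ _ _ _ (fun k => x i 0 - k.+1%:R^-1)
   (fun k => x i 0 + k.+1%:R^-1)).
- apply: nearW => k; rewrite mxE.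
  by have [_] := qx k i; rewrite ler_distl.
- rewrite -[X in _ --> X]subr0; apply: cvgB; first exact: cvg_cst.
  exact: cvg_harmonic.
- rewrite -[X in _ --> X]addr0; apply: cvgD; first exact: cvg_cst.
  exact: cvg_harmonic.
Qed.

(** A strict bound on a supremum leaves a uniform slack 1/(k+1). The resulting non-strict inequality
    passes to limits, so rational points suffice and the condition becomes countable. *)
Lemma ball_dist_ltP (m n : nat) (f g : 'cV[R]_m -> 'cV[R]_n) (e : R) :
  coord_continuous f -> coord_continuous g ->
  (ball_dist f g < e%:E)%E <->
  exists k : nat, forall q : 'cV[rat]_m,
    enorm (map_mx ratr q : 'cV[R]_m) <= 1 ->
    enorm (f (map_mx ratr q) - g (map_mx ratr q)) <= e - k.+1%:R^-1.
Proof.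
move=> fc gc; split=> [fge|[k fgk]].
  have ub x : enorm x <= 1 -> ((enorm (f x - g x))%:E <= ball_dist f g)%E.
    by move=> x1; apply: ereal_sup_ubound; exists x.
  have : exists2 r : R, r < e & (ball_dist f g <= r%:E)%E.
    move: fge; case: (ball_dist f g) => [r| |] //.
      by rewrite lte_fin => re; exists r.
    by move=> _; exists (e - 1); rewrite ?leNye// ltrBlDr ltrDl.
  move=> [r re fgr].
  have [k ke] : exists k : nat, k.+1%:R^-1 < e - r.
    exists (Num.truncn (e - r)^-1).
    rewrite invf_plt ?posrE ?subr_gt0//; exact: truncnS_gt.
  exists k => q q1; have := le_trans (ub _ q1) fgr.
  by rewrite lee_fin => /le_trans; apply; rewrite lerBrDl -lerBrDr ltW.
apply: (@le_lt_trans _ _ (e - k.+1%:R^-1)%:E); last first.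
  by rewrite lte_fin ltrBlDr ltrDl invr_gt0.
apply: ge_ereal_sup => _ [x /= x1 <-]; rewrite lee_fin.
have [q [q1 qx]] := ball_rat_dense x1.
apply: (@cvgr_to_le _ \oo _ _ (fun j =>
  enorm (f (map_mx ratr (q j)) - g (map_mx ratr (q j))))).
  apply: (enorm_coord_cvg (u := fun j =>
    f (map_mx ratr (q j)) - g (map_mx ratr (q j)))) => i.
  rewrite !mxE; under eq_cvg do rewrite !mxE.
  by apply: cvgB; [exact: (fc _ _ qx)|exact: (gc _ _ qx)].
by apply: nearW => j; exact: fgk.
Qed.

Lemma target_ball_dist_separated (d : nat) (U V : 'M[R]_d)
    (g : 'cV[R]_d -> 'cV[R]_d) (e : R) :
  (ball_dist (target U) g < e%:E)%E -> (ball_dist (target V) g < e%:E)%E ->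
  opball (2 * e) (U - V).
Proof.
move=> Ug Vg x x1.
have xe W : (ball_dist (target W) g < e%:E)%E -> enorm (W *m x - g x) <= e.
  move=> Wg; rewrite -lee_fin -target_mulmx; apply: le_trans (ltW Wg).
  by apply: ereal_sup_ubound; exists x.
have -> : (U - V) *m x = (U *m x - g x) - (V *m x - g x).
  by rewrite mulmxBl opprB addrA subrK.
by apply: enormB_le; exact: xe.
Qed.

End Continuity.

(** * Measurability of the approximation events and double counting *)

Section Measurability.
Context (disp : measure_display) (Omega : measurableType disp) (R : realType)
  (P : probability Omega R).

Definition prune_with (m : nat) (hs : seq nat) (n : nat)
    (M : layers R m hs n) (S : layers bool m hs n) : layers R m hs n :=
  hadamard_layers (map_layers (fun b : bool => b%:R) S) M.

(** The input [X] is allowed to be random because, in the induction, the output of the first layer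
    is the input of the rest. *)
Lemma measurable_network (m : nat) (hs : seq nat) (n : nat)
    (M : layers {RV P >-> R} m hs n) (S : layers bool m hs n)
    (X : Omega -> 'cV[R]_m) :
  (forall i, measurable_fun setT (fun w => X w i 0)) ->
  forall i, measurable_fun setT
    (fun w => network (prune_with (realization M w) S) (X w) i 0).
Proof.
have mul p q (A : 'M[{RV P >-> R}]_(p, q)) (B : 'M[bool]_(p, q))
    (Y : Omega -> 'cV[R]_q) :
    (forall i, measurable_fun setT (fun w => Y w i 0)) ->
    forall i, measurable_fun setT (fun w => (hadamard
      (map_mx (fun b : bool => b%:R) B)
      (map_mx (fun Z : {RV P >-> R} => Z w) A) *m Y w) i 0).
  move=> Ym i; under eq_fun do rewrite mxE.
  apply: measurable_sum => j; under eq_fun do rewrite !mxE.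
  apply: measurable_funM; last exact: Ym.
  by apply: measurable_funM; [exact: measurable_cst|exact: measurable_funP].
elim: hs m M S X => [|s hs IH] m M S X Xm /=; first exact: mul.
apply: (IH _ M.2 S.2) => i; under eq_fun do rewrite mxE.
apply: measurable_maxr; last exact: measurable_cst.
exact: mul.
Qed.

(* [P] is only meaningful on measurable sets, so the supremum over the ball is
   first reduced to rational points, through the continuity of networks. *)
Lemma measurable_pruned_close (d : nat) (hs : seq nat)
    (M : layers {RV P >-> R} d hs d) (S : layers bool d hs d)
    (W : 'M[R]_d) (e : R) :
  measurable [set w |
    (ball_dist (target W) (network (prune_with (realization M w) S)) < e%:E)%E].
Proof.
have tc : coord_continuous (target W).
  have -> : target W = mulmx W by apply/funext => x; exact: target_mulmx.
  exact: mulmx_coord_continuous.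
pose F k (q : 'cV[rat]_d) := [set w |
  enorm (target W (map_mx ratr q) -
         network (prune_with (realization M w) S) (map_mx ratr q))
  <= e - k.+1%:R^-1].
(* Points outside the ball contribute the empty set, so the union can range over all rational
   vectors. *)
pose G k q := if enorm (map_mx ratr q : 'cV[R]_d) <= 1 then ~` F k q else set0.
rewrite [X in measurable X](_ : _ = \bigcup_k ~` \bigcup_q G k q); last first.
  apply/seteqP; split=> w /=.
    move=> /(ball_dist_ltP _ tc (@network_coord_continuous _ _ _ _ _))[k kP].
    by exists k => // -[q _]; rewrite /G; case: ifP => // q1; apply; exact: kP.
  move=> [k _ kP].
  apply/(ball_dist_ltP _ tc (@network_coord_continuous _ _ _ _ _)).
  exists k => q q1; apply: contrapT => qN; apply: kP; exists q => //.
  by rewrite /G q1.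
apply: bigcupT_measurable => k; apply: measurableC.
apply: countable_bigcupT_measurable; first exact: countableP.
move=> q; rewrite /G; case: ifP => // _; apply: measurableC.
rewrite /F -[X in measurable X]setTI; apply: measurable_fun_le => //.
apply: measurableT_comp.
  by apply: continuous_measurable_fun; exact: @sqrt_continuous.
apply: measurable_sum => i; apply: measurable_funX.
under eq_fun do rewrite mxE [X in _ + X]mxE.
apply: measurable_funB; first exact: measurable_cst.
by apply: measurable_network => j; exact: measurable_cst.
Qed.

Lemma measure_bigsetU_le (T : eqType) (s : seq T) (F : T -> set Omega) :
  (forall t, measurable (F t)) ->
  (P (\big[setU/set0]_(t <- s) F t) <= \sum_(t <- s) P (F t))%E.
Proof.
move=> Fm; elim: s => [|t s IH]; first by rewrite !big_nil measure0.
rewrite !big_cons; apply: le_trans (measureU2 _ _ _) _ => //.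
  exact: bigsetU_measurable.
exact: leeD2l.
Qed.

Lemma sum_pairwise_disjoint_le1 (I : choiceType) (s : seq I) (r : rel I)
    (F : I -> set Omega) :
  (forall i, measurable (F i)) -> pairwise r s ->
  (forall i j, r i j -> F i `&` F j = set0) ->
  (\sum_(i <- s) P (F i) <= 1)%E.
Proof.
move=> Fm rs rF.
have -> : (\sum_(i <- s) P (F i) = P (\big[setU/set0]_(i <- s) F i))%E.
  elim: s rs => [|i s IH] /=; first by rewrite !big_nil measure0.
  move=> /andP[/allP ris rs]; rewrite !big_cons measureU ?IH//.
    exact: bigsetU_measurable.
  rewrite -bigcup_seq setI_bigcupr; apply: bigcup0 => j /= js.
  exact/rF/ris.
by apply: probability_le1; exact: bigsetU_measurable.
Qed.

(* Double counting of the pairs (i, t) such that [F i t] occurs. *)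
Lemma pairwise_exclusive_size_le (I : choiceType) (s : seq I) (r : rel I)
    (T : finType) (F : I -> T -> set Omega) :
  (forall i t, measurable (F i t)) -> pairwise r s ->
  (forall i j t, r i j -> F i t `&` F j t = set0) ->
  (forall i, i \in s -> ((1 / 2)%:E <= P (\bigcup_t F i t))%E) ->
  (size s <= 2 * #|T|)%N.
Proof.
move=> Fm rs rF Fs.
have : (\sum_(i <- s) (1 / 2 : R)%:E <= \sum_(t : T) (1 : R)%:E)%E.
  (* The double sum is bounded below by the union bound for each [i] and above, after exchange, by
     disjointness for each [t]. *)
  apply: (@le_trans _ _ (\sum_(i <- s) \sum_(t : T) P (F i t))%E).
    rewrite big_seq [leRHS]big_seq; apply: lee_sum => i /Fs /le_trans; apply.
    rewrite [X in P X](_ : _ = \big[setU/set0]_(t : T) F i t).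
      exact: measure_bigsetU_le.
    rewrite -bigcup_seq; apply/esym/eq_bigcupl.
    by split=> t //= _; apply: mem_index_enum.
  rewrite exchange_big /=; apply: lee_sum => t _.
  by apply: (@sum_pairwise_disjoint_le1 _ _ r) => // i j; exact: rF.
rewrite !sumEFin lee_fin sumr_const big_const_seq count_predT iter_addr_0.
rewrite -(ler_nat R) natrM -[_ *+ size s]mulr_natl -[_ *+ #|_|]mulr_natl mulr1.
by rewrite mul1r ler_pdivrMr// mulrC.
Qed.

End Measurability.

(** * Counting masks and the final bounds *)

Lemma layers_bool_enum (m : nat) (hs : seq nat) (n : nat) :
  exists (T : finType) (f : T -> layers bool m hs n),
    #|T| = (2 ^ nparams m hs n)%N /\ forall S, exists t, f t = S.
Proof.
elim: hs m => [|s hs IH] m /=.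
  exists 'M[bool]_(n, m), id; rewrite card_mx card_bool; split=> // S.
  by exists S.
have [T [f [cT fS]]] := IH s.
exists ('M[bool]_(s, m) * T)%type, (fun p => (p.1, f p.2)).
rewrite card_prod card_mx card_bool cT expnD; split=> // -[A S].
by have [t <-] := fS S; exists (A, t).
Qed.

Lemma opseparated_size_le (R : realType) (disp : measure_display)
    (Omega : measurableType disp) (P : probability Omega R)
    (d : nat) (hs : seq nat) (M : layers {RV P >-> R} d hs d) (e : R)
    (s : seq 'M[R]_d) :
  (forall h : 'cV[R]_d -> 'cV[R]_d, target_class h ->
     ((1 / 2)%:E <= P [set w | exists g' : 'cV[R]_d -> 'cV[R]_d,
        pruned (realization M w) g' /\ (ball_dist h g' < e%:E)%E])%E) ->
  (forall W, W \in s -> opball 1 W) -> opseparated (2 * e) s ->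
  (size s <= 2 * 2 ^ nparams d hs d)%N.
Proof.
(* Masks are indexed through a surjection from a finite type, which is enough to write the event of
   [hP] as a finite union. *)
move=> hP sB ss; have [T [f [cT fS]]] := layers_bool_enum d hs d.
rewrite -cT; apply: (@pairwise_exclusive_size_le _ _ _ P _ s _ _
  (fun W t => [set w | (ball_dist (target W)
     (network (prune_with (realization M w) (f t))) < e%:E)%E]) _ ss).
- by move=> W t; exact: measurable_pruned_close.
- move=> U V t /asboolP UV; rewrite -subset0 => w [/= Uw Vw]; apply: UV.
  exact: target_ball_dist_separated Uw Vw.
- move=> W Ws; have := hP (target W); rewrite (_ : [set w | _] = \bigcup_t
    [set w | (ball_dist (target W)
       (network (prune_with (realization M w) (f t))) < e%:E)%E]).
    by apply; exists W => //=; exact/opball_opnorm/sB.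
  apply/seteqP; split=> w /=.
    move=> [_ [[S _ <-] We]].
    by have [t tS] := fS S; exists t => //=; rewrite tS.
  move=> [t _ /= We]; exists (network (prune_with (realization M w) (f t))).
  by split=> //; exists (f t).
Qed.

(** With L = ln(1/eps), logarithms give D (L - ln 2) <= (p + 1) ln 2. As eps <= 1/16, ln 2 <= L/4,
    so p ln 2 >= 3/4 D L - 1/4 D L; finally ln 2 <= 1. *)
Lemma nparams_bound (R : realType) (D p : nat) (eps : R) :
  (0 < D)%N -> 0 < eps <= 1 / 16 ->
  (2 * eps)^-1 ^+ D <= (2 * 2 ^ p)%:R ->
  1 / 2 * D%:R * ln (1 / eps) <= p%:R.
Proof.
move=> D0 /andP[e0 e1]; rewrite -expnS natrX => eD.
have D1 : 1 <= D%:R :> R by rewrite ler1n.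
have l2 : 0 < ln 2 :> R by rewrite ln_gt0// ltr1n.
have l21 : ln 2 <= 1 :> R.
  have h : -1 < 1 :> R by lra.
  by have := le_ln1Dx h; rewrite -[1 + 1]/2.
have : ln ((2 * eps)^-1 ^+ D) <= ln (2 ^+ p.+1) :> R.
  by rewrite ler_ln ?posrE ?exprn_gt0 ?invr_gt0 ?mulr_gt0.
have -> : ln (1 / eps) = - ln eps by rewrite div1r lnV.
have inv2e : ln (2 * eps)^-1 = - (ln 2 + ln eps) :> R.
  by rewrite lnV ?posrE ?mulr_gt0// lnM ?posrE.
rewrite !lnXn ?invr_gt0 ?mulr_gt0// inv2e.
rewrite -[X in X <= _ -> _]mulr_natl -[X in _ <= X -> _]mulr_natl -(natr1 p).
have l16 : 4 * ln 2 <= - ln eps.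
  have -> : 4 * ln 2 = ln (2 ^+ 4) :> R by rewrite lnXn// mulr_natl.
  rewrite -lnV ?posrE//.
  rewrite ler_ln ?posrE ?exprn_gt0 ?invr_gt0//.
  rewrite -[2 ^+ 4]invrK lef_pV2 ?posrE ?invr_gt0 ?exprn_gt0//; lra.
have p0 : 0 <= p%:R :> R by [].
set L := - ln eps in l16 *.
have -> : - (ln 2 + ln eps) = L - ln 2 by rewrite /L opprD addrC.
nra.
Qed.

Theorem theorem2 (R : realType) :
  exists c eps0 : R,
    [/\ 0 < c, 0 < eps0 < 1 &
      forall (d l : nat) (eps : R), (1 <= d)%N -> (1 <= l)%N ->
        0 < eps <= eps0 ->
      forall (disp : measure_display) (Omega : measurableType disp)
        (P : probability Omega R) (hs : seq nat),
        (size hs).+1 = l ->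
      forall M : layers {RV P >-> R} d hs d,
        (forall h : 'cV[R]_d -> 'cV[R]_d, target_class h ->
           ((1 / 2)%:E <=
              P [set w | exists g' : 'cV[R]_d -> 'cV[R]_d,
                   pruned (realization M w) g' /\
                   (ball_dist h g' < eps%:E)%E])%E) ->
        c * d%:R ^+ 2 * ln (1 / eps) <= (nparams d hs d)%:R /\
        (l = 2%N -> forall s : nat, hs = [:: s] ->
           c * d%:R * ln (1 / eps) <= s%:R)].
Proof.
exists (1 / 4), (1 / 16); split; [lra|lra|].
move=> d l eps d1 _ epsB disp Omega P hs _ M hP.
have /andP[e0 e16] := epsB.
have d0 : 1 <= d%:R :> R by rewrite ler1n.
have L0 : 0 <= ln (1 / eps) by rewrite ln_ge0// ler_pdivlMr//; lra.
have bound : 1 / 2 * (d%:R * d%:R) * ln (1 / eps) <= (nparams d hs d)%:R.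
  rewrite -natrM; apply: nparams_bound => //; first by rewrite muln_gt0 d1.
  apply: opseparated_bounded => // [|s sB ss]; first by rewrite mulr_gt0.
  exact: opseparated_size_le hP sB ss.
split=> [|_ s hsE].
  apply: le_trans bound; rewrite expr2 ler_wpM2r// ler_wpM2r ?mulr_ge0//; lra.
move: bound; rewrite hsE /= natrD !natrM => bound.
(* Two layers of width s have 2 d s parameters; dividing the bound d^2 L / 2, with L = ln(1/eps), by
   2 d explains the constant 1/4. *)
rewrite -(@ler_pM2l _ (2 * d%:R)); last by lra.
nra.
Qed.
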